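(* Let $M$ be a local doxastic Kripke model and let $\mathfrak{H}(M)$ be the hypergraph model associated with $M$. (1) If $M$ belongs to the class $\mathcal{K}_n^{te}$ of local and proper doxastic Kripke models that are transitive and Euclidean, then $\mathfrak{H}(M)$ belongs to the class $\mathcal{H}_n^{su}$ of simple and $n$-uniform hypergraph models. (2) If $M$ belongs to the class $\mathcal{K}_n^{ste}$ of local and proper doxastic Kripke models that are serial, transitive and Euclidean, then $\mathfrak{H}(M)$ belongs to the class $\mathcal{H}_n^{sut}$ of simple, $n$-uniform and tail-complete hypergraph models.
   Context: Fix a set $\mathcal{A}$ of $n\geq 1$ agents (finite, $|\mathcal{A}|=n$). Each $a\in\mathcal{A}$ has a countable set $\mathsf{Var}_a$ of propositional letters; these sets are pairwise disjoint, and $\mathsf{Var}:=\bigcup_{a\in\mathcal{A}}\mathsf{Var}_a$. Kripke models. A doxastic Kripke model is a triple $M=(W,R,V)$ with $W\neq\emptyset$ a set, $R$ assigning to each $a\in\mathcal{A}$ a relation $R_a\subseteq W\times W$, and $V:W\to\mathcal{P}(\mathsf{Var})$. It is serial/transitive/Euclidean if every $R_a$ is (Euclidean: $uR_av$ and $uR_aw$ imply $vR_aw$). For a relation $S$, $S^{\leftrightarrow}:=S\cup S^{-1}$ is its symmetric closure and $S^{\equiv}$ is the smallest equivalence relation containing $S$. $M$ is proper if for all $u\neq v$ in $W$ there is $a\in\mathcal{A}$ with $(u,v)\notin R_a^{\equiv}$. $M$ is local if for all $a\in\mathcal{A}$, $u,v\in W$: $(u,v)\in R_a^{\leftrightarrow}$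 implies $V(u)\cap\mathsf{Var}_a=V(v)\cap\mathsf{Var}_a$. Hypergraph models. A directed hyperedge over a set $\mathscr{V}$ is a pair $E=(X,Y)$ of finite disjoint (possibly empty) subsets of $\mathscr{V}$; $T(E):=X$ (tail), $H(E):=Y$ (head), $U(E):=T(E)\cup H(E)$. A directed hypergraph is a pair $G=(\mathscr{V}(G),\mathscr{E}(G))$ with $\mathscr{V}(G)$ a non-empty set and $\mathscr{E}(G)$ a set of directed hyperedges over $\mathscr{V}(G)$. $G$ is simple if for all $E_1,E_2\in\mathscr{E}(G)$, $E_1\neq E_2$ implies $U(E_1)\not\subseteq U(E_2)$; $k$-uniform if $|U(E)|=k$ for all $E\in\mathscr{E}(G)$; tail-complete if $\mathscr{V}(G)=\bigcup_{E\in\mathscr{E}(G)}T(E)$. A coloring of $G$ is a map $\chi:\mathscr{V}(G)\to\mathcal{A}$ such that for every $E\in\mathscr{E}(G)$ and all distinct $u,v\in U(E)$, $\chi(u)\neq\chi(v)$. A hypergraph model is a triple $(G,\chi,\ell)$ with $G$ a directed hypergraph, $\chi$ a coloring of $G$, and $\ell:\mathscr{V}(G)\to\mathcal{P}(\mathsf{Var})$ such that $\chi(u)=a$ implies $\ell(u)\subseteq\mathsf{Var}_a$. It is simple ($n$-uniform, tail-complete) if $G$ is. The model $\mathfrak{H}(M)$. Let $M=(W,R,V)$ be a local doxastic Kripke model. For each $(a,u)\in\mathcal{A}\times W$ let $x_u^a$ be a fresh element (distinct for distinct pairs), and let $[x_u^a]$ be its class under the equivalence relation $\{(x_u^a,x_v^a)\mid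 a\in\mathcal{A},(u,v)\in R_a^{\equiv}\}$. For $u\in W$ put $X_u:=\{[x_u^a]\mid a\in\mathcal{A},(u,u)\in R_a\}$ and $Y_u:=\{[x_u^a]\mid a\in\mathcal{A},(u,u)\notin R_a\}$. Then $\mathfrak{H}(M)=(G,\chi,\ell)$ with $\mathscr{V}(G)=\{[x_u^a]\mid a\in\mathcal{A},u\in W\}$, $\mathscr{E}(G)=\{(X_u,Y_u)\mid u\in W\}$, $\chi([x_u^a]):=a$, and $\ell([x_u^a]):=V(u)\cap\mathsf{Var}_a$ (these are well defined). *)

(* Defs.v *)
From Stdlib Require Import Relations.
From mathcomp Require Import all_boot.
From mathcomp Require Import boolp classical_sets functions cardinality.

Set Implicit Arguments.
Unset Strict Implicit.
Unset Printing Implicit Defensive.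

Local Open Scope classical_set_scope.

(* [A] is the finite set of agents, [P] a type containing all propositional
   letters, and [Var a] the set of letters of agent [a]. *)

Section Kripke.
Variables (A : finType) (P : Type) (Var : A -> set P).

Record kripke_model := KripkeModel {
  world : Type;
  world_nonempty : inhabited world;
  acc : A -> relation world;
  valuation : world -> set P;
  valuation_sub : forall u, valuation u `<=` \bigcup_a Var a
}.

Definition sym_closure (T : Type) (S : relation T) : relation T :=
  fun u v => S u v \/ S v u.

Definition equiv_closure (T : Type) (S : relation T) : relation T :=
  clos_refl_sym_trans T S.

Definition is_serial (M : kripke_model) : Prop :=
  forall (a : A) (u : world M), exists v, acc a u v.

Definition is_transitive (M : kripke_model) : Prop :=
  forall (a : A) (u v w : world M), acc a u v -> acc a v w -> acc a u w.

Definition is_euclidean (M : kripke_model) : Prop :=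
  forall (a : A) (u v w : world M), acc a u v -> acc a u w -> acc a v w.

Definition is_proper (M : kripke_model) : Prop :=
  forall u v : world M, u <> v -> exists a : A, ~ equiv_closure (acc a) u v.

Definition is_local (M : kripke_model) : Prop :=
  forall (a : A) (u v : world M), sym_closure (acc a) u v ->
    valuation u `&` Var a = valuation v `&` Var a.

Definition K_te (M : kripke_model) : Prop :=
  [/\ is_local M, is_proper M, is_transitive M & is_euclidean M].

Definition K_ste (M : kripke_model) : Prop :=
  [/\ is_local M, is_proper M, is_serial M, is_transitive M
             & is_euclidean M].

End Kripke.

Section Hypergraph.

(* The records [hypergraph_data] and [model_data] only carry the underlying
   data; the axioms are the predicates [is_dhypergraph] and
   [is_hypergraph_model].  The vertex set is a whole type, and a directed
   hyperedge is a pair (tail, head). *)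
Record hypergraph_data := HypergraphData {
  vertex : Type;
  hyperedges : set (set vertex * set vertex)
}.
Arguments hyperedges : clear implicits.

Definition etail (T : Type) (E : set T * set T) : set T := E.1.
Definition ehead (T : Type) (E : set T * set T) : set T := E.2.
Definition eunion (T : Type) (E : set T * set T) : set T :=
  etail E `|` ehead E.

Definition is_dhyperedge (T : Type) (E : set T * set T) : Prop :=
  [/\ finite_set (etail E), finite_set (ehead E)
    & etail E `&` ehead E = set0].

Definition is_dhypergraph (G : hypergraph_data) : Prop :=
  inhabited (vertex G) /\ forall E, hyperedges G E -> is_dhyperedge E.

Definition is_simple (G : hypergraph_data) : Prop :=
  forall E1 E2, hyperedges G E1 -> hyperedges G E2 ->
    E1 <> E2 -> ~ (eunion E1 `<=` eunion E2).

Definition is_uniform (k : nat) (G : hypergraph_data) : Prop :=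
  forall E, hyperedges G E -> (eunion E #= `I_k)%card.

Definition is_tail_complete (G : hypergraph_data) : Prop :=
  [set: vertex G] = \bigcup_(E in hyperedges G) etail E.

Variables (A : finType) (P : Type) (Var : A -> set P).

Definition is_coloring (G : hypergraph_data) (chi : vertex G -> A) : Prop :=
  forall E, hyperedges G E -> forall u v, eunion E u -> eunion E v ->
    u <> v -> chi u <> chi v.

Record model_data := ModelData {
  graph : hypergraph_data;
  color : vertex graph -> A;
  label : vertex graph -> set P
}.
Arguments color : clear implicits.
Arguments label : clear implicits.

Definition is_hypergraph_model (H : model_data) : Prop :=
  [/\ is_dhypergraph (graph H),
      is_coloring (color H),
      forall u, label H u `<=` \bigcup_a Var a
    & forall u a, color H u = a -> label H u `<=` Var a].

Definition H_su (n : nat) (H : model_data) : Prop :=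
  [/\ is_hypergraph_model H, is_simple (graph H)
             & is_uniform n (graph H)].

Definition H_sut (n : nat) (H : model_data) : Prop :=
  [/\ is_hypergraph_model H, is_simple (graph H),
               is_uniform n (graph H) & is_tail_complete (graph H)].

End Hypergraph.

Section HypergraphOfKripke.
Variables (A : finType) (P : Type) (Var : A -> set P) (M : kripke_model Var).

(* The fresh element x_u^a is the pair (a, u). *)
Definition xequiv : relation (A * world M) :=
  fun x y => x.1 = y.1 /\ equiv_closure (acc x.1) x.2 y.2.

Definition xclass (x : A * world M) : set (A * world M) :=
  [set y | xequiv x y].

Definition xvertex : Type :=
  {c : set (A * world M) | exists x, c = xclass x}.

Definition cls (a : A) (u : world M) : xvertex :=
  exist _ (xclass (a, u)) (ex_intro _ (a, u) erefl).

Definition Xtail (u : world M) : set xvertex :=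
  [set cls a u | a in [set a | acc a u u]].

Definition Yhead (u : world M) : set xvertex :=
  [set cls a u | a in [set a | ~ acc a u u]].

Definition xgraph : hypergraph_data :=
  HypergraphData (range (fun u : world M => (Xtail u, Yhead u))).

(* Color and label are computed from a chosen representative of the class;
   [xcolor_cls] and [xlabel_cls] show that the choice is irrelevant (for the
   label, when [M] is local). *)
Definition xrep (c : xvertex) : A * world M := sval (cid (svalP c)).

Definition xcolor (c : xvertex) : A := (xrep c).1.

Definition xlabel (c : xvertex) : set P :=
  valuation (xrep c).2 `&` Var (xrep c).1.

Definition hypergraph_of : model_data A P :=
  @ModelData A P xgraph xcolor xlabel.

Lemma xrep_cls a u : xequiv (xrep (cls a u)) (a, u).
Proof.
rewrite /xrep; case: cid => x /= clsE.
have : xclass (a, u) (a, u) by split => //; apply: rst_refl.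
by rewrite clsE.
Qed.

Lemma xcolor_cls a u : xcolor (cls a u) = a.
Proof. by case: (xrep_cls a u). Qed.

Lemma xlabel_cls a u : is_local M -> xlabel (cls a u) = valuation u `&` Var a.
Proof.
move=> locM; rewrite /xlabel; case: (xrep_cls a u).
case: xrep => b v /= -> {b}.
elim=> [x y xy|//|x y _ ->//|x y z _ -> _ -> //].
by apply: locM; left.
Qed.

End HypergraphOfKripke.

(* Main.v *)
Require Import Defs.
From Stdlib Require Import Relations.
From mathcomp Require Import all_boot.
From mathcomp Require Import boolp classical_sets functions cardinality.

(** The union of the hyperedge of [u] is the set of all classes [x_u^a], one for
    each agent [a], and [[x_u^a] = [x_v^b]] iff [a = b] and [u], [v] are related
    by the equivalence closure of [R_a].  So an inclusion between the hyperedges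
    of [u] and [v] relates [u] and [v] for every agent, and properness gives
    [u = v].  For tail-completeness, an [R_a]-successor [v] of [u] is reflexive
    by Euclideanity, hence [[x_u^a] = [x_v^a]] lies in the tail of [v]. *)

Local Open Scope classical_set_scope.

Lemma card_setT_finType (T : finType) : ([set: T] #= `I_#|T|)%card.
Proof.
apply/card_set_bijP; exists (fun x : T => nat_of_ord (enum_rank x)); split.
- by move=> x _ /=; apply: ltn_ord.
- by move=> x y _ _ /ord_inj /enum_rank_inj.
- by move=> i ltiT; exists (enum_val (Ordinal ltiT)); rewrite ?enum_valK.
Qed.

Section HypergraphOfKripke.
Context {A : finType} {P : Type} {Var : A -> set P} {M : kripke_model Var}.
Implicit Types (a b : A) (u v : world M).

Lemma eq_clsP a b u v :
  cls a u = cls b v <-> a = b /\ equiv_closure (acc a) u v.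
Proof.
split=> [clsE|[<- uv]].
  (* This membership unfolds to the goal; it holds because [(b, v)] lies in its own class. *)
  suff : xclass (a, u) (b, v) by [].
  have -> : xclass (a, u) = xclass (b, v) := congr1 sval clsE.
  by split=> //; apply: rst_refl.
apply: eq_exist; apply/seteqP.
split=> -[c w] [/= <- ?]; split=> //=.
  by apply: (rst_trans _ _ _ u) => //; apply: rst_sym.
by apply: (rst_trans _ _ _ v).
Qed.

Lemma xvertex_cls (c : xvertex M) : exists a u, c = cls a u.
Proof. by case: c => c [[a u] cE]; exists a, u; apply: eq_exist. Qed.

(** Tail and head are the images under [cls] of complementary sets of agents. *)
Lemma eunion_xedge u :
  eunion (Xtail u, Yhead u) = [set cls a u | a in [set: A]].
Proof. by rewrite /eunion /etail /ehead /= -image_setU setUv. Qed.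

(** The agent [a] serves to exhibit a vertex, which takes an agent as well as a world. *)
Lemma hypergraph_of_model a :
  is_local M -> is_hypergraph_model Var (hypergraph_of M).
Proof.
move=> locM; split.
- split; first by have [u] := world_nonempty M; exact: inhabits (cls a u).
  move=> _ [u _ <-]; split; [exact: finite_image|exact: finite_image|].
  (* A common vertex would make a single agent both reflexive and irreflexive at [u]. *)
  apply/seteqP; split=> // _ [[b bu <-] [c cu /eq_clsP[cb _]]].
  by apply: cu; rewrite cb.
- move=> _ [u _ <-] x y; rewrite eunion_xedge => -[b _ <-] [c _ <-] neq.
  by rewrite /= !xcolor_cls => bc; apply: neq; rewrite bc.
- by move=> c p [_ Vp]; exists (xrep c).1.
- by move=> c b <- p [].
Qed.

Lemma hypergraph_of_simple : is_proper M -> is_simple (graph (hypergraph_of M)).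
Proof.
move=> propM _ _ [u _ <-] [v _ <-] neq; rewrite !eunion_xedge => sub.
have [b] : exists b, ~ equiv_closure (acc b) u v.
  by apply: propM => uv; apply: neq; rewrite uv.
(* The vertex [cls b u] equals some [cls c v], and comparing colors forces [c = b]. *)
apply; have [|c _ /esym/eq_clsP[]//] := sub (cls b u).
by exists b.
Qed.

(** At a fixed world, distinct agents give distinct classes, so each hyperedge is in bijection with
    [A]. *)
Lemma hypergraph_of_uniform : is_uniform #|A| (graph (hypergraph_of M)).
Proof.
move=> _ [u _ <-]; rewrite eunion_xedge.
apply: card_eq_trans (card_setT_finType A); apply: inj_card_eq.
by move=> b c _ _ /eq_clsP[].
Qed.

Lemma hypergraph_of_tail_complete :
  is_serial M -> is_euclidean M -> is_tail_complete (graph (hypergraph_of M)).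
Proof.
move=> serM eucM; apply/seteqP; split=> // c _.
have [b [u ->]] := xvertex_cls c.
have [v uv] := serM b u.
exists (Xtail v, Yhead v); first by exists v.
exists b; first exact: (eucM _ _ _ _ uv uv).
by apply/eq_clsP; split=> //; apply: rst_sym; apply: rst_step.
Qed.

End HypergraphOfKripke.

Theorem proposition3 (A : finType) (n : nat) (n_ge1 : (1 <= n)%N)
    (cardA : #|A| = n)
    (P : Type) (Var : A -> set P)
    (countable_Var : forall a : A, countable (Var a))
    (disjoint_Var : trivIset [set: A] Var)
    (M : kripke_model Var) (local_M : is_local M) :
  (K_te M -> H_su Var n (hypergraph_of M)) /\
  (K_ste M -> H_sut Var n (hypergraph_of M)).
Proof.
have /card_gt0P[a _] : (0 < #|A|)%N by rewrite cardA.
rewrite -cardA; split=> [[_ propM _ _]|[_ propM serM _ eucM]]; split.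
- exact: hypergraph_of_model a local_M.
- exact: hypergraph_of_simple.
- exact: hypergraph_of_uniform.
- exact: hypergraph_of_model a local_M.
- exact: hypergraph_of_simple.
- exact: hypergraph_of_uniform.
- exact: hypergraph_of_tail_complete.
Qed.
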